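(* Consider the single-block problem $\min_{x\in X}f(x):=g(x)+h(x)$, assumed convex with attained global minimum and $X\cap\mathrm{int}(\mathrm{dom}\,f)\neq\emptyset$, and suppose that $u(v;x)$ satisfies Assumption C: (a) $u(x;x)=g(x)$ for all $x\in X$; (b) $u(v;x)\ge g(v)$ for all $v,x\in X$; (c) $\nabla u(x;x)=\nabla g(x)$ for all $x\in X$; (d) $\|\nabla u(v;x)-\nabla u(\hat v;x)\|\le L\|v-\hat v\|$ for all $v,\hat v,x\in X$, with a constant $L>0$. Then the iterates of the SUM algorithm $x^{r+1}\in\arg\min_{x\in X}u(x;x^r)+h(x)$ satisfy, for all $r\ge 1$, $$\Delta^{r+1}\le\frac{c_4}{\sigma_4}\frac1r,\qquad\text{with }\sigma_4=\frac{1}{32R^2L},\quad c_4=\max\{4\sigma_4-2,\ f(x^1)-f^*,\ 2\}.$$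
   Context: $g$ is smooth and convex; $h$ is convex, possibly nonsmooth and possibly extended-valued; $X\subseteq\mathbb{R}^n$ is convex; $f$ is closed, proper, convex. $\nabla u(v;x)$ is the gradient in the first argument $v$; no strong convexity of $u(\cdot;x)$ is assumed, nor Lipschitz continuity of $\nabla u(v;x)$ in $x$. $X^*$ is the optimal solution set, $f^*$ the optimal value, $\Delta^r=f(x^r)-f^*$, and $R=\max_{x\in X}\max_{x^*\in X^*}\{\|x-x^*\|:f(x)\le f(x^1)\}$. The level set $\{x:f(x)\le f(x^1)\}$ is assumed compact so that $R$ is finite; $R>0$ and finiteness of $f(x^r)$, $r\ge1$, are understood. *)

(* Defs.v *)
From HB Require Import structures.
From mathcomp Require Import all_boot all_order all_algebra.
From mathcomp Require Import all_classical all_reals all_analysis.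

Set Implicit Arguments.
Unset Strict Implicit.
Unset Printing Implicit Defensive.

Import Order.TTheory GRing.Theory Num.Theory.
Import numFieldNormedType.Exports.

Local Open Scope classical_set_scope.
Local Open Scope ring_scope.

(* The library norm on 'rV[R]_n is the sup norm; it is only used through the
   topology (and differentiability) it induces. *)
Definition enorm (R : realType) (n : nat) (v : 'rV[R]_n) : R :=
  Num.sqrt (\sum_(i < n) v 0 i ^+ 2).

Definition grad (R : realType) (n : nat) (F : 'rV[R]_n -> R) (v : 'rV[R]_n) :
    'rV[R]_n :=
  \row_(i < n) 'D_(delta_mx 0 i) F v.

(* F is an everywhere defined function, differentiable (as a function on R^n)
   at the points of X; its values away from X are irrelevant. *)
Definition differentiable_on (R : realType) (n : nat) (X : set 'rV[R]_n)
    (F : 'rV[R]_n -> R) : Prop :=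
  forall v, X v -> differentiable F v.

Definition smooth_on (R : realType) (n : nat) (X : set 'rV[R]_n)
    (F : 'rV[R]_n -> R) : Prop :=
  differentiable_on X F /\ {within X, continuous (grad F)}.

Section ExtendedValued.
Local Open Scope ereal_scope.
Context (R : realType) (n : nat).
Implicit Types (f h F : 'rV[R]_n -> \bar R) (X : set 'rV[R]_n).

Definition eff_dom f : set 'rV[R]_n := [set z | f z < +oo].

Definition proper_fun f : Prop := eff_dom f !=set0 /\ (forall z, -oo < f z).

(* Usual inequality form of convexity for functions into ]-oo, +oo]. The value
   -oo is ruled out by properness wherever this predicate is used. *)
Definition econvex f : Prop :=
  forall (y z : 'rV[R]_n) (t : R), (0 < t < 1)%R ->
    f (t *: y + (1 - t) *: z)%R <= t%:E * f y + (1 - t)%:E * f z.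

Definition closed_fun f : Prop :=
  closed [set p : 'rV[R]_n * R | f p.1 <= p.2%:E].

Definition argmin X F : set 'rV[R]_n :=
  [set z | X z /\ forall y, X y -> F z <= F y].

Definition objective (g : 'rV[R]_n -> R) h : 'rV[R]_n -> \bar R :=
  fun z => (g z)%:E + h z.

Definition optval X f : \bar R := ereal_inf (f @` X).

(* For a compact level set the distances below are bounded, so this real
   supremum is the genuine one; it is the maximum whenever one is attained,
   which can fail only when X is not closed. *)
Definition level_radius X f (x1 : 'rV[R]_n) : R :=
  sup [set d | exists z zs, [/\ X z, f z <= f x1, argmin X f zs
                              & d = enorm (z - zs)]].

End ExtendedValued.

(* u v x is u(v; x): the variable first, the base point second. *)
Record sum_surrogate (R : realType) (n : nat) (X : set 'rV[R]_n)
    (g : 'rV[R]_n -> R) (u : 'rV[R]_n -> 'rV[R]_n -> R) (L : R) : Prop := {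
  surrogate_differentiable : forall x, X x -> differentiable_on X (u^~ x) ;
  surrogate_tight : forall x, X x -> u x x = g x ;
  surrogate_upper : forall v x, X v -> X x -> g v <= u v x ;
  surrogate_grad : forall x, X x -> grad (u^~ x) x = grad g x ;
  surrogate_lipschitz : forall v w x, X v -> X w -> X x ->
    enorm (grad (u^~ x) v - grad (u^~ x) w) <= L * enorm (v - w)
}.

(* Main.v *)
Require Import Defs.

From mathcomp Require Import all_boot all_order all_algebra.
From mathcomp Require Import all_classical all_reals all_analysis.
Import Order.TTheory GRing.Theory Num.Theory.
Import numFieldNormedType.Exports.
From mathcomp Require Import ring lra.
Local Open Scope classical_set_scope.
Local Open Scope ring_scope.

(** Along the segment from [x r] to a minimizer [xs], the surrogate overestimates
    the objective only to second order. Indeed [u(.; x r)] has an [L]-Lipschitz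
    gradient and touches [g] to first order at [x r], so [descent_lemma] bounds
    it by the linearization of [g] at [x r] plus [L/2 |z - x r|^2], and convexity
    puts that linearization below [g] ([convex_derive_le]). As [x r.+1] minimizes
    the surrogate model, which dominates the objective, [sum_step_le] gives
    [f (x r.+1) <= f z + L/2 |z - x r|^2] for every [z] in [X].

    With [z = x r] the values decrease, so all iterates stay in the initial level
    set, within distance [rho] of [xs] ([level_radius_ge]). With
    [z = x r + t (xs - x r)], convexity of [f] turns the estimate into the scalar
    recursion [D (r+1) <= (1 - t) D r + L rho^2 t^2 / 2] for the optimality gaps,
    for every [t] in [(0, 1]]. The choice [t = 2 / (r + 1)] yields
    [D (r+1) <= 2 L rho^2 / (r + 1)] ([recursion_rate]), and since [c4 >= 2] the
    claimed bound is at least [64 L rho^2 / r]. *)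

(** * The Euclidean norm *)

Lemma enorm_sqr (R : realType) (n : nat) (v : 'rV[R]_n) :
  enorm v ^+ 2 = \sum_(i < n) v 0 i ^+ 2.
Proof. by rewrite sqr_sqrtr// sumr_ge0// => i _; exact: sqr_ge0. Qed.

Lemma enorm_ge0 (R : realType) (n : nat) (v : 'rV[R]_n) : 0 <= enorm v.
Proof. exact: sqrtr_ge0. Qed.

Lemma enormZ (R : realType) (n : nat) (t : R) (v : 'rV[R]_n) :
  0 <= t -> enorm (t *: v) = t * enorm v.
Proof.
move=> t0; rewrite /enorm -[X in X * _](ger0_norm t0) -sqrtr_sqr.
rewrite -sqrtrM ?sqr_ge0//; congr (Num.sqrt _); rewrite mulr_sumr.
by apply: eq_bigr => i _; rewrite mxE exprMn.
Qed.

Lemma enormN (R : realType) (n : nat) (v : 'rV[R]_n) : enorm (- v) = enorm v.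
Proof. by congr (Num.sqrt _); apply: eq_bigr => i _; rewrite mxE sqrrN. Qed.

(** Cauchy-Schwarz when the ratio [k] of the norms is known: it is then the sum
    over the coordinates of Young's inequality [2ab <= a^2/k + k b^2]. *)
Lemma dot_le_enorm (R : realType) (n : nat) (k : R) (w d : 'rV[R]_n) :
  0 < k -> enorm w <= k * enorm d ->
  \sum_(i < n) d 0 i * w 0 i <= k * enorm d ^+ 2.
Proof.
move=> k0 wd.
have young : \sum_(i < n) d 0 i * w 0 i
    <= (2 * k)^-1 * enorm w ^+ 2 + k / 2 * enorm d ^+ 2.
  rewrite !enorm_sqr !mulr_sumr -big_split/=; apply: ler_sum => i _.
  rewrite -subr_ge0.
  have -> : (2 * k)^-1 * w 0 i ^+ 2 + k / 2 * d 0 i ^+ 2 - d 0 i * w 0 i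
            = (2 * k)^-1 * (w 0 i - k * d 0 i) ^+ 2.
    by field; rewrite gt_eqF.
  by rewrite mulr_ge0 ?sqr_ge0// invr_ge0 mulr_ge0// ltW.
apply: (le_trans young).
have -> : k * enorm d ^+ 2
          = (2 * k)^-1 * (k * enorm d) ^+ 2 + k / 2 * enorm d ^+ 2.
  by field; rewrite gt_eqF.
rewrite lerD2r ler_pM2l ?invr_gt0 ?mulr_gt0//.
by rewrite lerXn2r// nnegrE ?enorm_ge0// mulr_ge0 ?enorm_ge0// ltW.
Qed.

(** * Smooth and convex functions along a segment *)

Lemma derive_gradE (R : realType) (n : nat) (F : 'rV[R]_n -> R)
    (p d : 'rV[R]_n) : differentiable F p ->
  'D_d F p = \sum_(i < n) d 0 i * grad F p 0 i.
Proof.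
move=> dF; rewrite deriveE// [in LHS](row_sum_delta d) linear_sum.
by apply: eq_bigr => i _; rewrite linearZ/= mxE deriveE.
Qed.

Lemma is_derive_line (R : realType) (n : nat) (F : 'rV[R]_n -> R)
    (p d : 'rV[R]_n) (s : R) : differentiable F (p + s *: d) ->
  is_derive s 1 (fun t : R => F (p + t *: d)) ('D_d F (p + s *: d)).
Proof.
move=> dF.
have /derivableP[] : derivable F (p + s *: d) d by exact: diff_derivable.
have quotE : (fun h : R => h^-1 *: (((fun t : R => F (p + t *: d)) \o shift s)
      (h *: 1) - F (p + s *: d)))
    = (fun h => h^-1 *: ((F \o shift (p + s *: d)) (h *: d) - F (p + s *: d))).
  apply/funext => h /=; congr (_ *: (F _ - _)).
  by rewrite scalerDl addrCA /GRing.scale/= mulr1.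
by move=> dfF _; split; rewrite /derivable /derive quotE.
Qed.

Lemma convex_set_line (R : realType) (n : nat) (X : set 'rV[R]_n)
    (x z : 'rV[R]_n) (t : R) : convex_set X -> X x -> X z -> 0 <= t <= 1 ->
  X (x + t *: (z - x)).
Proof.
move=> cX Xx Xz /andP[t0 t1].
have := cX z x (Itv01 t0 t1); rewrite !inE => /(_ Xz Xx).
suff -> : conv (Itv01 t0 t1) (z : convex_lmodType 'rV[R]_n) x
   = (x + t *: (z - x)) :> 'rV[R]_n by [].
rewrite /conv/= /unstable.onem scalerBl scale1r scalerBr.
by rewrite addrCA.
Qed.

(** The difference quotients of a convex function along the segment from [x]
    to [z] are bounded by [g z - g x], hence so is their limit. *)
Lemma convex_derive_le (R : realType) (n : nat) (X : set 'rV[R]_n)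
    (g : 'rV[R]_n -> R) (x z : 'rV[R]_n) :
  convex_function X g -> X x -> X z -> differentiable g x ->
  g x + 'D_(z - x) g x <= g z.
Proof.
move=> cg Xx Xz dg; rewrite addrC -lerBrDr.
have : derivable g x (z - x) by exact: diff_derivable.
move=> /cvg_dnbhs_at_right gq.
apply: (cvgr_to_le gq); near=> h.
have h0 : 0 < h by near: h; exact: nbhs_right_gt.
have h1 : h <= 1 by near: h; apply: nbhs_right_le.
have := cg (Itv01 (ltW h0) h1) z x; rewrite !inE => /(_ Xz Xx).
have -> : conv (Itv01 (ltW h0) h1) (z : convex_lmodType 'rV[R]_n) x
   = (h *: (z - x) + x) :> 'rV[R]_n.
  by rewrite /conv/= /unstable.onem scalerBl scale1r scalerBr -addrA
    [x - _]addrC.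
rewrite convRE /unstable.onem/= => gle.
rewrite /GRing.scale/= mulrC ler_pdivrMr// lerBlDr.
by apply: (le_trans gle); rewrite le_eqVlt; apply/orP; left; apply/eqP; ring.
Unshelve. all: by end_near. Qed.

(** The mean value theorem applied to the gap between [F] along the segment
    and its quadratic model: the derivative of the gap at [c] is the variation
    of the directional derivative minus [L c |z - x|^2], which the Lipschitz
    bound makes nonpositive. *)
Lemma descent_lemma (R : realType) (n : nat) (X : set 'rV[R]_n)
    (F : 'rV[R]_n -> R) (L : R) (x z : 'rV[R]_n) :
  convex_set X -> differentiable_on X F -> 0 < L ->
  (forall v w, X v -> X w -> enorm (grad F v - grad F w) <= L * enorm (v - w)) ->
  X x -> X z ->
  F z <= F x + 'D_(z - x) F x + L / 2 * enorm (z - x) ^+ 2.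
Proof.
move=> cX dF L0 lipF Xx Xz; set d := z - x.
set a := 'D_d F x; set b := L / 2 * enorm d ^+ 2.
have onX (t : R) : 0 <= t <= 1 -> X (x + t *: d) by exact: convex_set_line.
pose psi := (fun t : R => F (x + t *: d))
  - (a *: (id : R -> R) + b *: ((id : R -> R) ^+ 2)).
pose dpsi (t : R) : R := 'D_d F (x + t *: d) - (a + 2 * b * t).
have dpsiP (t : R) : 0 <= t <= 1 -> is_derive t 1 psi (dpsi t).
  move=> /onX/dF/is_derive_line dFt.
  apply: is_derive_eq; rewrite /dpsi /GRing.scale/= expr1 mulr1; ring.
have [||c c01 psic] := @MVT R psi dpsi 0 1 ltr01.
- by move=> t; rewrite in_itv/= => /andP[/ltW t0 /ltW t1]; apply/dpsiP/andP.
- apply: derivable_within_continuous => t; rewrite in_itv/= => t01.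
  by have [] := dpsiP _ t01.
have /andP[c0 c1] : 0 < c < 1 by rewrite in_itv in c01.
have dle : dpsi c <= 0.
  have Xc : X (x + c *: d) by apply: onX; rewrite !ltW.
  rewrite /dpsi /a opprD addrA subr_le0.
  rewrite !derive_gradE; [|exact: dF..].
  rewrite -sumrB (eq_bigr (fun i : 'I_n => d 0 i *
     (grad F (x + c *: d) - grad F x) 0 i)); last first.
    by move=> i _; rewrite !mxE -mulrBr.
  have -> : 2 * b * c = (L * c) * enorm d ^+ 2 by rewrite /b; field.
  apply: dot_le_enorm; first exact: mulr_gt0.
  apply: le_trans (lipF _ _ Xc Xx) _.
  by rewrite addrAC subrr add0r enormZ ?(ltW c0)// mulrA.
move: psic; rewrite subr0 mulr1 => psic.
have : psi 1 - psi 0 <= 0 by rewrite psic.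
have psiE t : psi t = F (x + t *: d) - (a * t + b * t ^+ 2) by [].
rewrite !psiE scale0r scale1r addr0 /d addrCA subrr addr0 => gap_le0.
lra.
Qed.

(** * One step of the algorithm *)

(** The model [u(.; x) + h] exceeds [f] by at most [L/2 |z - x|^2]: the descent
    lemma bounds [u(z; x)] by its quadratic expansion at [x], whose affine part
    is the linearization of [g] and lies below [g]. Minimality of [y] for the
    model and [g <= u(.; x)] transfer the bound to [f y]. *)
Lemma sum_step_le (R : realType) (n : nat) (X : set 'rV[R]_n)
    (g : 'rV[R]_n -> R) (h : 'rV[R]_n -> \bar R)
    (u : 'rV[R]_n -> 'rV[R]_n -> R) (L : R) (x y z : 'rV[R]_n) :
  convex_set X -> differentiable_on X g -> convex_function X g -> 0 < L ->
  sum_surrogate X g u L -> X x -> X z ->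
  argmin X (fun v => (u v x)%:E + h v)%E y ->
  (objective g h y <= objective g h z + (L / 2 * enorm (z - x) ^+ 2)%:E)%E.
Proof.
move=> cX dg cg L0 [du ut uu ug ul] Xx Xz [Xy ymin].
have uz : u z x <= g z + L / 2 * enorm (z - x) ^+ 2.
  apply: le_trans (descent_lemma _ _ X (u^~ x) L x z cX (du x Xx) L0 _ Xx Xz) _.
    by move=> v w Xv Xw; exact: ul.
  rewrite ut// lerD2r derive_gradE; last exact: du.
  by rewrite ug// -derive_gradE ?(convex_derive_le _ _ X)//; exact: dg.
rewrite /objective addeAC -EFinD.
apply: (@le_trans _ _ ((u y x)%:E + h y)%E).
  by apply: leeD => //; rewrite lee_fin uu.
apply: le_trans (ymin z Xz) _.
by apply: leeD => //; rewrite lee_fin.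
Qed.

(** * The convergence rate *)

(** Induction on [r], with [t = 2 / (r + 1)]. At [r = 1] this is [t = 1], which
    cancels [D 1], so the bound depends on [M] alone. *)
Lemma recursion_rate (R : realType) (D : nat -> R) (M : R) :
  0 <= M ->
  (forall r (t : R), (1 <= r)%N -> 0 < t <= 1 ->
     D r.+1 <= (1 - t) * D r + M / 2 * t ^+ 2) ->
  forall r, (1 <= r)%N -> D r.+1 <= 2 * M / r.+1%:R.
Proof.
move=> M0 Drec; elim=> // r IH _.
have r1 : 0 < 1 + r%:R :> R by rewrite ltr_pwDl.
have r2 : 0 < 2 + r%:R :> R by rewrite ltr_pwDl.
have rE : r.+2%:R = 2 + r%:R :> R by rewrite -[r.+2]add2n natrD.
have rE1 : r.+1%:R = 1 + r%:R :> R by rewrite -[r.+1]add1n natrD.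
have t01 : 0 < (2 : R) / r.+2%:R <= 1.
  by rewrite divr_gt0//= ler_pdivrMr// mul1r ler_nat.
have step := Drec r.+1 _ (ltn0Sn r) t01.
have tE : 1 - 2 / r.+2%:R = r%:R / r.+2%:R :> R.
  by rewrite rE; field; rewrite gt_eqF.
rewrite tE in step.
have rD : r%:R * D r.+1 <= r%:R * (2 * M / r.+1%:R).
  (* For [r = 0] the induction hypothesis is void, but its factor [r] vanishes. *)
  case: r IH {r1 r2 rE rE1 t01 step tE} => [|r] IH; first by rewrite !mul0r.
  by rewrite ler_wpM2l// IH.
apply: (le_trans step).
apply: (@le_trans _ _ (r%:R * (2 * M / r.+1%:R) / r.+2%:R
    + M / 2 * (2 / r.+2%:R) ^+ 2)).
  by rewrite lerD2r mulrAC ler_wpM2r// invr_ge0.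
rewrite rE rE1 -subr_ge0.
have -> : 2 * M / (2 + r%:R) - (r%:R * (2 * M / (1 + r%:R)) / (2 + r%:R)
    + M / 2 * (2 / (2 + r%:R)) ^+ 2)
  = 2 * M / ((1 + r%:R) * (2 + r%:R) ^+ 2).
  by field; rewrite ?gt_eqF.
by rewrite divr_ge0 ?mulr_ge0// ltW// exprn_gt0.
Qed.

(** The real [sup] of a set that is empty or unbounded is [0] by convention, so a
    positive radius is a genuine supremum. *)
Lemma level_radius_ge (R : realType) (n : nat) (X : set 'rV[R]_n)
    (f : 'rV[R]_n -> \bar R) (x1 z zs : 'rV[R]_n) :
  0 < level_radius X f x1 -> X z -> (f z <= f x1)%E -> argmin X f zs ->
  enorm (z - zs) <= level_radius X f x1.
Proof.
move=> rho0 Xz fz zsP; rewrite /level_radius in rho0 *.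
have sE : has_sup [set d | exists z zs, [/\ X z, (f z <= f x1)%E,
    argmin X f zs & d = enorm (z - zs)]].
  by apply: contrapT => /sup_out s0; rewrite s0 ltxx in rho0.
by apply: (sup_upper_bound sE); exists z, zs.
Qed.

Lemma optval_argmin (R : realType) (n : nat) (X : set 'rV[R]_n)
    (f : 'rV[R]_n -> \bar R) (zs : 'rV[R]_n) :
  argmin X f zs -> optval X f = f zs.
Proof.
move=> [Xzs zsmin]; apply/le_anti/andP; split.
  by apply: ereal_inf_lbound; exists zs.
by apply/ereal_infP => _ [y Xy <-]; exact: zsmin.
Qed.

Theorem mainTheorem4 (R : realType) (n : nat) (X : set 'rV[R]_n)
    (g : 'rV[R]_n -> R) (h : 'rV[R]_n -> \bar R)
    (u : 'rV[R]_n -> 'rV[R]_n -> R) (L : R) (x : nat -> 'rV[R]_n)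
    (f := objective g h) (rho := level_radius X f (x 1%N))
    (X_convex : convex_set X)
    (g_smooth : smooth_on X g) (g_convex : convex_function X g)
    (h_convex : econvex h)
    (f_closed : closed_fun f) (f_proper : proper_fun f) (f_convex : econvex f)
    (min_attained : argmin X f !=set0)
    (X_int_dom : X `&` (eff_dom f)° !=set0)
    (L_gt0 : 0 < L)
    (u_surrogate : sum_surrogate X g u L)
    (x1_in_X : X (x 1%N))
    (sum_step : forall r : nat, (1 <= r)%N ->
       argmin X (fun v => (u v (x r))%:E + h v)%E (x r.+1))
    (f_finite : forall r : nat, (1 <= r)%N -> f (x r) \is a fin_num)
    (level_compact : compact [set z | (f z <= f (x 1%N))%E])
    (rho_gt0 : 0 < rho) :
  let Delta := fun r : nat => (f (x r) - optval X f)%E in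
  let sigma4 : R := 1 / (32%:R * rho ^+ 2 * L) in
  let c4 : \bar R :=
    maxe (maxe (4%:R * sigma4 - 2%:R)%:E (f (x 1%N) - optval X f)%E) (2%:R)%:E in
  forall r : nat, (1 <= r)%N ->
    (Delta r.+1 <= c4 * (sigma4^-1)%:E * (1 / r%:R)%:E)%E.
Proof.
move=> Delta sigma4 c4.
have [xs xsP] := min_attained; have [Xxs xsmin] := xsP.
have Xx r : (1 <= r)%N -> X (x r).
  by case: r => [//|[//|r]] _; have [] := sum_step r.+1 isT.
have step r z : (1 <= r)%N -> X z ->
    (f (x r.+1) <= f z + (L / 2 * enorm (z - x r) ^+ 2)%:E)%E.
  move=> r1 Xz.
  by apply: (sum_step_le _ _ X g h u) u_surrogate (Xx r r1) Xz (sum_step r r1) => //;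
     case: g_smooth.
have descent r : (1 <= r)%N -> (f (x r) <= f (x 1%N))%E.
  elim: r => [//|[//|r] IH] _; apply: le_trans (IH isT).
  have := step r.+1 (x r.+1) isT (Xx r.+1 isT).
  by rewrite subrr -(scale0r 0) enormZ// mul0r expr0n mulr0 adde0.
have rhoP r : (1 <= r)%N -> enorm (xs - x r) <= rho.
  move=> r1; rewrite -enormN opprB.
  by apply: level_radius_ge => //; [exact: Xx|exact: descent].
have fxs : f xs \is a fin_num.
  rewrite fin_numE; case: f_proper => _ /(_ xs); rewrite ltNye => -> /=.
  have := xsmin _ x1_in_X; move: (f_finite 1%N isT).
  by case: (f xs) => //; case: (f (x 1%N)).
pose D r := fine (f (x r)) - fine (f xs).
have DE r : (1 <= r)%N -> Delta r = (D r)%:E.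
  by move=> r1; rewrite /Delta (optval_argmin _ _ _ _ _ xsP) EFinB !fineK// f_finite.
pose M := L * rho ^+ 2.
have M0 : 0 < M by rewrite mulr_gt0// exprn_gt0.
have Drec r t : (1 <= r)%N -> 0 < t <= 1 ->
    D r.+1 <= (1 - t) * D r + M / 2 * t ^+ 2.
  move=> r1 t01; have /andP[t0 t1] := t01.
  pose z := x r + t *: (xs - x r).
  have Xz : X z by apply: convex_set_line => //; [exact: Xx|rewrite (ltW t0)].
  have fz : (f z <= (t * fine (f xs) + (1 - t) * fine (f (x r)))%:E)%E.
    (* [econvex] covers [0 < t < 1]; at [t = 1] the point [z] is [xs]. *)
    move: t1; rewrite le_eqVlt => /orP[/eqP tE|t1].
      rewrite /z tE scale1r addrC subrK subrr mul0r addr0 mul1r.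
      by rewrite fineK.
    have := f_convex xs (x r) t; rewrite t0 t1 => /(_ isT).
    have -> : t *: xs + (1 - t) *: x r = z.
      by rewrite /z scalerBl scale1r scalerBr addrCA.
    by move=> /le_trans; apply; rewrite [leRHS]EFinD !EFinM !fineK// f_finite.
  have := step r z r1 Xz => /le_trans /(_ (leeD2r _ fz)).
  rewrite -[X in (X <= _)%E]fineK ?f_finite// -EFinD lee_fin => le1.
  have zx : enorm (z - x r) ^+ 2 <= t ^+ 2 * rho ^+ 2.
    rewrite /z addrAC subrr add0r enormZ ?(ltW t0)// exprMn ler_wpM2l ?sqr_ge0//.
    by rewrite lerXn2r ?nnegrE ?enorm_ge0 ?(ltW rho_gt0)// rhoP.
  have := ler_wpM2l (ltW L_gt0) zx; rewrite /D /M; lra.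
move=> r r1.
have rate := recursion_rate _ D M (ltW M0) Drec r r1.
have sigmaE : sigma4^-1 = 32 * M by rewrite /sigma4 /M div1r invrK; ring.
rewrite DE// sigmaE.
have c4ge : (2%:E <= c4)%E by rewrite /c4 le_max lexx orbT.
apply: (@le_trans _ _ (2%:E * (32 * M)%:E * (1 / r%:R)%:E)%E).
  rewrite -!EFinM lee_fin; apply: (le_trans rate).
  have r0 : 0 < r%:R :> R by rewrite ltr0n.
  apply: (@le_trans _ _ (2 * M / r%:R)).
    by rewrite ler_wpM2l ?mulr_ge0 ?ltW// ltf_pV2 ?posrE ?ltr0n// ltr_nat.
  rewrite mul1r ler_pM2r ?invr_gt0//; lra.
apply: lee_wpmul2r; first by rewrite lee_fin divr_ge0.
by apply: lee_wpmul2r => //; rewrite lee_fin mulr_ge0// ltW.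
Qed.
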